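(* Let $(K,|\cdot|_K)$ be an archimedean local field and let $n \in \mathbb{N}$. There exists a constant $C_n \geq 1$, depending only on $n$, such that the following holds. Let $N \geq 1$ and suppose $(x_1,\dots,x_n), (y_1,\dots,y_n) \in B_K(0,1)^n$ satisfy $$|x_1^j + \cdots + x_n^j - y_1^j - \cdots - y_n^j|_K \leq N^{-n} \qquad \text{for all } 1 \leq j \leq n.$$ Then there exists a permutation $\sigma$ of $\{1,\dots,n\}$ such that $|x_j - y_{\sigma(j)}|_K \leq C_n N^{-1}$ for all $1 \leq j \leq n$.
   Context: An archimedean local field is $K = \mathbb{R}$ or $K = \mathbb{C}$, with $|\cdot|_K$ the usual absolute value (modulus). $B_K(0,1) := \{z \in K : |z|_K \leq 1\}$. Here $N$ is a real number. *)

(* Defs.v *)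
From mathcomp Require Import all_boot all_order all_fingroup all_algebra.
From mathcomp Require Import reals.
From mathcomp.real_closed Require Import complex.

Set Implicit Arguments.
Unset Strict Implicit.
Unset Printing Implicit Defensive.

Import Order.TTheory GRing.Theory Num.Theory.
Local Open Scope ring_scope.

(* The type is indexed by a model [R] of the real numbers; since the two
   fields form a single type, a constant chosen before the field is shared
   by both. *)
Variant arch_local_field (R : realType) := ArchReal | ArchComplex.

Definition carrier (R : realType) (K : arch_local_field R) : numFieldType :=
  match K with
  | ArchReal => R
  | ArchComplex => R[i]
  end.

Coercion carrier : arch_local_field >-> Num.NumField.type.

(* MathComp's norm on R[i] takes its values in R[i]; the absolute value is
   made R-valued by means of the modulus [normc (a +i* b) = sqrt (a^2 + b^2)],
   for which `|z| = (normc z)%:C. *)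
Definition absK (R : realType) (K : arch_local_field R) : K -> R :=
  match K return K -> R with
  | ArchReal => fun x : R => `|x|
  | ArchComplex => fun z : R[i] => Normc.normc z
  end.

Arguments absK {R} K _.

Definition unit_ball (R : realType) (K : arch_local_field R) : {pred K} :=
  [pred z | absK K z <= 1].

Arguments unit_ball {R} K.

(* Main.v *)
Require Import Defs.
From mathcomp Require Import all_boot all_order all_fingroup all_algebra.
From mathcomp Require Import reals ring lra.
From mathcomp.real_closed Require Import complex.

Set Implicit Arguments.
Unset Strict Implicit.
Unset Printing Implicit Defensive.

Import Order.TTheory GRing.Theory Num.Theory.
Local Open Scope ring_scope.

(** The real case embeds in the complex one by [x |-> x%:C], so everything
    happens in [R[i]].  Write p and q for the monic polynomials with roots
    x_1, ..., x_n and y_1, ..., y_n, and e = N^-n.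

    Newton's identities express the coefficients of a monic polynomial through
    the first n power sums of its roots, so the coefficients of p and q differ
    by O(e), and |p(z) - q(z)| = O(e) on every fixed disc
    ([horner_prod_XsubC_dist]).  This alone only says that each x_i is near
    some y_j; the multiplicities must be matched as well.

    For this, cut the 2n points into clusters.  Among the scales c/N * L^k,
    with k at most the number (2n)^2 of pairs of points, one scale t has no
    pairwise distance between t and L t ([scale_gap]).  Being within t is then
    an equivalence relation whose classes are L t apart from each other.  Let
    w be a point, and suppose that a of the x_i and b of the y_j lie within t
    of it.  When z moves from w + 4t to w + 4Kt, each nearby root multiplies
    |p(z)| by about K and each remote one by about 1, always up to a factor 2
    ([cluster_growth]); hence |p| grows by K^a up to 2^n, and |q| by K^b.
    Both |p| and |q| are at least t^n >= c e at these two points, and c is so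
    large that |p - q| is at most half of this; so the two growths agree up to
    a factor 4, and K > 4^(n+1) forces a = b
    ([cluster_card_eq]).  Every cluster thus contains as many x_i as y_j, and
    any bijection that respects the clusters moves points by at most
    t <= c L^(4 n^2) / N ([cluster_matching]). *)

(** * Newton's identities *)

Lemma deriv_prod (R : comNzRingType) (I : eqType) (r : seq I)
    (F : I -> {poly R}) : uniq r ->
  (\prod_(i <- r) F i)^`() =
    \sum_(i <- r) (F i)^`() * \prod_(j <- r | j != i) F j.
Proof.
elim: r => [|a r IH] /=; first by rewrite !big_nil derivC.
case/andP=> ar ur; rewrite !big_cons derivM (IH ur) eqxx /=; congr (_ + _).
  congr (_ * _); rewrite big_seq [RHS]big_seq_cond; apply: eq_bigl => i.
  by case: (boolP (i \in r)) => //= ir; apply/esym; apply: contraNneq ar => <-.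
rewrite mulr_sumr; apply: eq_big_seq => i ir.
rewrite big_cons ifT; first by rewrite mulrCA.
by apply: contraNneq ar => ->.
Qed.

(** The recurrence compares coefficients in p = ('X - a) * h; solving it from the
    top degree downwards is synthetic division by 'X - a. *)
Lemma backward_recurrence (R : comNzRingType) (a : R) (c g : nat -> R) :
    (forall m, c m = g m - a * g m.+1) ->
  forall k m, g m = \sum_(l < k) c (m + l)%N * a ^+ l + a ^+ k * g (m + k)%N.
Proof.
move=> rec; elim=> [|k IH] m; first by rewrite big_ord0 addn0; ring.
rewrite {1}(IH m) big_ord_recr /= rec addnS exprSr; ring.
Qed.

(** Compare coefficients in 'X * p' = sum_i 'X * p / ('X - x_i), the quotients
    being expanded by synthetic division.  The factor 'X makes the identity
    uniform: for m = 0 it is the sum of the relations p(x_i) = 0.  The term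
    l = 0 contributes n * p`_m, so p`_m is determined by the higher
    coefficients and the power sums of exponents 1 to n - m. *)
Lemma newton_identity (R : comNzRingType) n (x : 'I_n -> R) m : (m <= n)%N ->
  let p := \prod_(i < n) ('X - (x i)%:P) in
  p`_m *+ m = \sum_(l < n.+1 - m) p`_(m + l) * \sum_(i < n) x i ^+ l.
Proof.
move=> mn p.
pose q i := 'X * \prod_(j < n | j != i) ('X - (x j)%:P).
have qE i k : (q i)`_k = \sum_(l < n.+1 - k) p`_(k + l) * x i ^+ l.
  have rec j : p`_j = (q i)`_j - x i * (q i)`_j.+1.
    rewrite /p (bigD1 i) //= mulrBl coefB mulrC coefMX coefCM /q !coefXM /=.
    by rewrite eq_sym.
  rewrite (backward_recurrence rec (n.+1 - k)).
  rewrite [X in _ + _ * X]nth_default ?mulr0 ?addr0 //.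
  have -> : (k + (n.+1 - k) = maxn k n.+1)%N by rewrite maxnE.
  rewrite (leq_trans _ (leq_maxr _ _)) // /q mulrC -big_filter.
  rewrite size_mulX ?monic_neq0 ?monic_prod_XsubC // size_prod_XsubC.
  rewrite size_filter -sum1_count sum1_card cardC1 card_ord.
  by rewrite prednK // (leq_ltn_trans _ (ltn_ord i)).
have dp : 'X * p^`() = \sum_(i < n) q i.
  rewrite /p deriv_prod ?index_enum_uniq // mulr_sumr; apply: eq_bigr => i _.
  by rewrite derivXsubC mul1r.
have -> : p`_m *+ m = ('X * p^`())`_m.
  rewrite coefXM coef_deriv; case: (m) => //=; by rewrite mulr0n.
rewrite dp coef_sum (eq_bigr _ (fun i _ => qE i m)) exchange_big /=.
by apply: eq_bigr => l _; rewrite mulr_sumr.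
Qed.

(** * Stability of a monic polynomial under perturbation of its power sums *)

Lemma norm_coef_prod_XsubC (F : numDomainType) (I : Type) (r : seq I)
    (x : I -> F) k : (forall i, `|x i| <= 1) ->
  `|(\prod_(i <- r) ('X - (x i)%:P))`_k| <= 2 ^+ size r.
Proof.
move=> x1; elim: r k => [|a r IH] k /=.
  by rewrite big_nil coef1 normr_nat; case: eqP.
rewrite big_cons mulrBl coefB coefXM coefCM.
rewrite (le_trans (ler_normB _ _)) // exprS mulr_natl mulr2n lerD //.
  by case: eqP => _; rewrite ?IH // normr0 exprn_ge0.
by rewrite normrM -[leRHS]mul1r ler_pM.
Qed.

(** The constant is crude but depends on n only.  By Newton's identities,
    j times the difference of the coefficients of degree n - j is a sum of j
    differences of products of an earlier coefficient, at most 2^n, and a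
    power sum, at most n; dividing by j only helps in characteristic 0. *)
Lemma coef_prod_XsubC_dist (F : numDomainType) n (x y : 'I_n -> F) (e : F) j :
  0 <= e -> (forall i, `|x i| <= 1) -> (forall i, `|y i| <= 1) ->
  (forall l, (1 <= l <= n)%N ->
     `|\sum_(i < n) x i ^+ l - \sum_(i < n) y i ^+ l| <= e) ->
  (j <= n)%N ->
  `|(\prod_(i < n) ('X - (x i)%:P))`_(n - j) -
    (\prod_(i < n) ('X - (y i)%:P))`_(n - j)|
    <= (n * (n + 2 ^ n))%:R ^+ j * e.
Proof.
move=> e0 x1 y1 He; set p := \prod_(i < n) _; set q := \prod_(i < n) _.
pose px l := \sum_(i < n) x i ^+ l; pose py l := \sum_(i < n) y i ^+ l.
set D := (n * _)%:R.
have size_ord : size (index_enum 'I_n) = n.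
  by rewrite -[RHS](size_enum_ord n) enumT.
have top z : (\prod_(i < n) ('X - (z i)%:P) : {poly F})`_n = 1.
  have := size_prod_XsubC (index_enum 'I_n) z; rewrite size_ord => sz.
  have := monic_prod_XsubC (index_enum 'I_n) xpredT z.
  by move/monicP; rewrite /lead_coef sz.
elim/ltn_ind: j => -[|j] IH jn.
  by rewrite subn0 !top subrr normr0 expr0 mul1r.
have n0 : (0 < n)%N by rewrite (leq_trans _ jn).
have D1 : 1 <= D by rewrite ler1n muln_gt0 n0 addn_gt0 n0.
set m := (n - j.+1)%N.
have mn : (m <= n)%N by rewrite leq_subr.
(* Newton's identity with the term in [c`_m] itself moved to the left. *)
have rec z : let c := \prod_(i < n) ('X - (z i)%:P) : {poly F} in
    c`_m *+ j.+1 = - \sum_(l < j.+1) c`_(n - (j - l)) * \sum_(i < n) z i ^+ l.+1.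
  move=> c; have := newton_identity z mn; rewrite -/c /=.
  have -> : (n.+1 - m = j.+2)%N by rewrite /m subSn // subKn.
  rewrite big_ord_recl addn0 /=.
  under [\sum_(i < n) z i ^+ 0]eq_bigr => i _ do rewrite expr0.
  rewrite sumr_const card_ord mulr_natr => h.
  have hn : c`_m *+ n = c`_m *+ m + c`_m *+ j.+1.
    by rewrite -mulrnDr subnK.
  move: h; rewrite hn -[LHS]addr0 -addrA => /addrI/esym/eqP.
  rewrite addr_eq0 => /eqP ->; congr (- _); apply: eq_bigr => l _.
  congr (_`_ _ * _); rewrite /m /=; have := ltn_ord l; rewrite ltnS => lj.
  rewrite /bump /= add1n subnBA //.
  by rewrite addnS -addSn subnSK // addnBAC // ltnW.
rewrite -[leLHS]mul1r (le_trans (y := j.+1%:R * `|p`_m - q`_m|)) //.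
  by rewrite ler_wpM2r // ler1n.
rewrite -[X in X * _]normr_nat -normrM mulr_natl mulrnBl !rec -opprB opprK normrN.
rewrite addrC -sumrB (le_trans (ler_norm_sum _ _ _)) //.
have term (l : 'I_j.+1) : `|p`_(n - (j - l)) * px l.+1 - q`_(n - (j - l)) * py l.+1|
    <= D ^+ j * (n + 2 ^ n)%:R * e.
  have -> : p`_(n - (j - l)) * px l.+1 - q`_(n - (j - l)) * py l.+1 =
    (p`_(n - (j - l)) - q`_(n - (j - l))) * px l.+1
    + q`_(n - (j - l)) * (px l.+1 - py l.+1) by ring.
  rewrite (le_trans (ler_normD _ _)) // natrD.
  rewrite [in leRHS]mulrDr [in leRHS]mulrDl lerD // normrM.
    rewrite mulrAC ler_pM //.
      rewrite (le_trans (IH (j - l)%N _ _)) ?ltnS ?leq_subr //.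
        by rewrite (leq_trans (leq_subr _ _)) // ltnW.
      by rewrite ler_wpM2r // ler_weXn2l ?leq_subr.
    rewrite (le_trans (ler_norm_sum _ _ _)) //.
    rewrite -[n in leRHS]card_ord -sumr_const ler_sum // => i _.
    by rewrite normrX exprn_ile1.
  rewrite ler_pM //; last first.
    by rewrite He //= (leq_trans (ltn_ord l)).
  rewrite natrX -[leLHS]mul1r ler_pM //.
    by rewrite exprn_ege1.
  have := norm_coef_prod_XsubC (index_enum 'I_n) (n - (j - l)) y1.
  by rewrite size_ord.
rewrite (le_trans (ler_sum _ (fun l _ => term l))) //.
rewrite sumr_const card_ord exprSr -[leLHS]mulr_natl [X in _ <= _ * X * _]natrM.
rewrite !mulrA ler_wpM2r // ler_wpM2r // mulrC ler_wpM2l ?ler_nat //.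
by rewrite exprn_ge0 // (le_trans ler01).
Qed.

Lemma horner_prod_XsubC_dist (F : numDomainType) n (x y : 'I_n -> F) (e z : F)
    (b : nat) :
  0 <= e -> (forall i, `|x i| <= 1) -> (forall i, `|y i| <= 1) ->
  (forall l, (1 <= l <= n)%N ->
     `|\sum_(i < n) x i ^+ l - \sum_(i < n) y i ^+ l| <= e) ->
  `|z| <= b.+1%:R ->
  `|\prod_(i < n) (z - x i) - \prod_(i < n) (z - y i)|
    <= (n.+1 * ((n * (n + 2 ^ n)) ^ n * b.+1 ^ n))%:R * e.
Proof.
move=> e0 x1 y1 He zb.
have hE u : \prod_(i < n) (z - u i) = (\prod_(i < n) ('X - (u i)%:P)).[z].
  by rewrite horner_prod; apply: eq_bigr => i _; rewrite hornerXsubC.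
have expand u : \prod_(i < n) (z - u i) =
    \sum_(k < n.+1) (\prod_(i < n) ('X - (u i)%:P))`_k * z ^+ k.
  rewrite hE (@horner_coef_wide _ n.+1) // size_prod_XsubC.
  by rewrite -[index_enum _]enumT size_enum_ord.
rewrite !expand -sumrB (le_trans (ler_norm_sum _ _ _)) //.
have term (k : 'I_n.+1) : `|(\prod_(i < n) ('X - (x i)%:P))`_k * z ^+ k -
      (\prod_(i < n) ('X - (y i)%:P))`_k * z ^+ k| <=
    ((n * (n + 2 ^ n)) ^ n * b.+1 ^ n)%:R * e.
  have kn : (k <= n)%N by rewrite -ltnS.
  rewrite -mulrBl normrM normrX natrM !natrX mulrAC ler_pM ?exprn_ge0 //.
    have := coef_prod_XsubC_dist e0 x1 y1 He (leq_subr k n); rewrite subKn //.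
    move/le_trans; apply; rewrite ler_wpM2r //.
    case: (posnP n) => [n0|n0].
      have -> : nat_of_ord k = 0%N
        by apply/eqP; rewrite -leqn0 -[X in (_ <= X)%N]n0.
      by rewrite subn0.
    by rewrite ler_weXn2l ?leq_subr // ler1n muln_gt0 n0 addn_gt0 n0.
  rewrite (le_trans (lerXn2r _ _ _ zb)) ?nnegrE //.
  by rewrite ler_weXn2l // ler1n.
rewrite (le_trans (ler_sum _ (fun k _ => term k))) //.
by rewrite sumr_const card_ord -[leLHS]mulr_natl [X in _ <= X * _]natrM mulrA.
Qed.

(** * The modulus on R[i] *)

Local Notation modulus := Normc.normc.

Lemma normCE (R : rcfType) (z : R[i]) : `|z| = (modulus z)%:C%C.
Proof. by []. Qed.

Lemma modulus_prod (R : rcfType) (I : Type) (r : seq I) (z : I -> R[i]) :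
  modulus (\prod_(i <- r) z i) = \prod_(i <- r) modulus (z i).
Proof.
by apply: (big_morph _ (@Normc.normcM R)); rewrite Normc.normc1.
Qed.

Lemma modulusB (R : rcfType) (u v : R[i]) : modulus (u - v) = modulus (v - u).
Proof. by rewrite -normcN opprB. Qed.

Lemma modulus_real (R : rcfType) (a : R) : modulus a%:C%C = `|a|.
Proof. by rewrite /= expr0n addr0 sqrtr_sqr. Qed.

Lemma modulus_triangle (R : rcfType) (u v w : R[i]) :
  modulus (u - w) <= modulus (u - v) + modulus (v - w).
Proof. by have := le_normcD (u - v) (v - w); rewrite addrA subrK. Qed.

Lemma modulus_shift (R : rcfType) (w x : R[i]) (s : R) : 0 <= s ->
  [/\ modulus (w + s%:C%C - x) <= modulus (x - w) + s,
      modulus (x - w) - s <= modulus (w + s%:C%C - x) &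
      s - modulus (x - w) <= modulus (w + s%:C%C - x)].
Proof.
move=> s0; set v := w + _.
have vw : modulus (v - w) = s.
  by rewrite /v addrC addKr modulus_real ger0_norm.
have h1 := modulus_triangle v w x; have h2 := modulus_triangle x v w.
have h3 := modulus_triangle v x w.
rewrite (modulusB w x) (modulusB x v) vw in h1 h2 h3.
split; lra.
Qed.

(** * Counting the roots of a cluster *)

Definition cluster (R : rcfType) n (x : 'I_n -> R[i]) (w : R[i]) (t : R) :=
  [set i | modulus (x i - w) <= t].

(** Moving the evaluation point from w + 4t to w + 4Kt multiplies the distance
    to a root within t of w by a factor between K/2 and 2K, and the distance to a
    root beyond (8K + 8)t by one between 1/2 and 2. *)
Lemma cluster_growth (R : rcfType) n (w : R[i]) (x : 'I_n -> R[i]) (K t : R) :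
    1 <= K -> 0 < t ->
    (forall i, modulus (x i - w) <= t \/ (8 * K + 8) * t < modulus (x i - w)) ->
  let a := #|cluster x w t| in
  let P s := modulus (\prod_(i < n) (w + (s * t)%:C%C - x i)) in
  [/\ t ^+ n <= P 4, t ^+ n <= P (4 * K), K ^+ a * P 4 <= 2 ^+ n * P (4 * K) &
      P (4 * K) <= 2 ^+ n * (K ^+ a * P 4)].
Proof.
move=> K1 t0 gap a P.
(* [k i] is the expected growth of the i-th factor. *)
pose k i := if modulus (x i - w) <= t then K else 1.
have -> : K ^+ a = \prod_(i < n) k i.
  by rewrite -big_mkcond -prodr_const; apply: eq_bigl => i; rewrite inE.
have cst (c : R) : c ^+ n = \prod_(i < n) c by rewrite prodr_const card_ord.
rewrite /P !modulus_prod !cst -!big_split /=.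
have Kt : t <= K * t by rewrite ler_peMl // ltW.
have s1 : 0 <= 4 * t by lra.
have s2 : 0 <= 4 * K * t by rewrite -mulrA; lra.
have fact i : [/\ t <= modulus (w + (4 * t)%:C%C - x i),
    t <= modulus (w + (4 * K * t)%:C%C - x i),
    k i * modulus (w + (4 * t)%:C%C - x i)
      <= 2 * modulus (w + (4 * K * t)%:C%C - x i) &
    modulus (w + (4 * K * t)%:C%C - x i)
      <= 2 * (k i * modulus (w + (4 * t)%:C%C - x i))].
  have [a1 a2 a3] := modulus_shift w (x i) s1.
  have [b1 b2 b3] := modulus_shift w (x i) s2.
  rewrite /k; case: (gap i) => h.
    rewrite h.
    set A := modulus (w + (4 * t)%:C%C - x i) in a1 a2 a3 *.
    have c1 : K * A <= K * (5 * t) by rewrite ler_wpM2l; lra.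
    have c2 : K * (3 * t) <= K * A by rewrite ler_wpM2l; lra.
    rewrite -!mulrA in b1 b2 b3 *; split; lra.
  have -> : modulus (x i - w) <= t = false by apply/negbTE; rewrite -ltNge; lra.
  rewrite -!mulrA in b1 b2 b3 *; split; lra.
have k0 i : 0 <= k i by rewrite /k; case: ifP => _; lra.
have m0 u : 0 <= modulus u by rewrite -lecR -normCE normr_ge0.
split; apply: ler_prod => i _; have [f1 f2 f3 f4] := fact i.
- by rewrite f1 ltW.
- by rewrite f2 ltW.
- by rewrite f3 mulr_ge0.
- by rewrite f4 m0.
Qed.

(** If there were more x_i than y_j near w, the growth of |p| would exceed that
    of |q| by a factor at least K, while both growths agree up to 4 * 2^n * 2^n:
    at both evaluation points |p - q| is at most half of |p| and of |q|. *)
Lemma cluster_card_le (R : rcfType) n (w : R[i]) (x y : 'I_n -> R[i]) (K t : R) :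
    4 ^+ n.+1 < K -> 0 < t ->
    (forall i, modulus (x i - w) <= t \/ (8 * K + 8) * t < modulus (x i - w)) ->
    (forall i, modulus (y i - w) <= t \/ (8 * K + 8) * t < modulus (y i - w)) ->
    (forall s, 0 <= s <= 4 * K * t ->
       modulus (\prod_(i < n) (w + s%:C%C - x i) - \prod_(i < n) (w + s%:C%C - y i))
         <= t ^+ n / 2) ->
  (#|cluster x w t| <= #|cluster y w t|)%N.
Proof.
move=> K4 t0 gx gy close.
have K1 : 1 <= K by rewrite (le_trans _ (ltW K4)) // exprn_ege1 // ler1n.
have [px1 _ gpx _] := cluster_growth K1 t0 gx.
have [_ qy2 _ gqy] := cluster_growth K1 t0 gy.
have Kt : t <= K * t by rewrite ler_peMl // ltW.
have T0 : 0 < t ^+ n by rewrite exprn_gt0.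
have c1 := close (4 * t); have c2 := close (4 * K * t).
rewrite leqNgt; apply/negP => lt_ab.
set a := #|_| in gpx lt_ab; set b := #|_| in gqy lt_ab.
set p1 := \prod_(i < n) (w + (4 * t)%:C%C - x i) in px1 gpx c1.
set p2 := \prod_(i < n) (w + (4 * K * t)%:C%C - x i) in gpx c2.
set q1 := \prod_(i < n) (w + (4 * t)%:C%C - y i) in gqy c1.
set q2 := \prod_(i < n) (w + (4 * K * t)%:C%C - y i) in qy2 gqy c2.
have {}c1 : modulus q1 <= 2 * modulus p1.
  have := modulus_triangle q1 p1 0; rewrite !subr0 (modulusB q1) => h.
  have {}c1 := c1 _; have := c1 ltac:(apply/andP; split; rewrite -?mulrA; lra).
  lra.
have {}c2 : modulus p2 <= 2 * modulus q2.
  have := modulus_triangle p2 q2 0; rewrite !subr0 => h.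
  have := c2 ltac:(apply/andP; split; rewrite -?mulrA; lra).
  lra.
have p0 : 0 < modulus p1 by rewrite (lt_le_trans _ px1) // exprn_gt0.
have Kb : 0 < K ^+ b by rewrite exprn_gt0 // (lt_le_trans ltr01).
have Kab : K * K ^+ b <= K ^+ a by rewrite -exprS ler_weXn2l.
set M : R := 2 ^+ n in gpx gqy.
have M0 : 0 < M by rewrite exprn_gt0.
have K4' : 4 * (M * M) < K by rewrite /M -exprMn_comm -?natrM // -exprS.
have : K * K ^+ b * modulus p1 <= 4 * (M * M) * (K ^+ b * modulus p1).
  apply: (le_trans (ler_wpM2r (ltW p0) Kab)).
  apply: (le_trans gpx).
  apply: (@le_trans _ _ (M * (2 * (M * (K ^+ b * (2 * modulus p1)))))).
    rewrite ler_wpM2l ?(ltW M0) //; apply: (le_trans c2).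
    rewrite ler_wpM2l //; apply: (le_trans gqy).
    by rewrite !ler_wpM2l // ltW.
  by rewrite le_eqVlt; apply/orP; left; apply/eqP; ring.
rewrite -mulrA ler_pM2r ?mulr_gt0 //; lra.
Qed.

Lemma cluster_card_eq (R : rcfType) n (w : R[i]) (x y : 'I_n -> R[i]) (K t : R) :
    4 ^+ n.+1 < K -> 0 < t ->
    (forall i, modulus (x i - w) <= t \/ (8 * K + 8) * t < modulus (x i - w)) ->
    (forall i, modulus (y i - w) <= t \/ (8 * K + 8) * t < modulus (y i - w)) ->
    (forall s, 0 <= s <= 4 * K * t ->
       modulus (\prod_(i < n) (w + s%:C%C - x i) - \prod_(i < n) (w + s%:C%C - y i))
         <= t ^+ n / 2) ->
  #|cluster x w t| = #|cluster y w t|.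
Proof.
move=> K4 t0 gx gy close; apply/eqP; rewrite eqn_leq.
rewrite (cluster_card_le K4) //= (cluster_card_le K4) // => s hs.
by rewrite modulusB close.
Qed.

(** * Scales and matchings *)

(** The intervals ]t0 L^k, t0 L^(k+1)] are pairwise disjoint, and one more of them
    is considered than there are values of d, so one of them contains no value. *)
Lemma scale_gap (R : realFieldType) (I : finType) (d : I -> R) (t0 L : R) :
    0 < t0 -> 1 <= L ->
  exists2 k, (k <= #|I|)%N &
    forall i, d i <= t0 * L ^+ k \/ L * (t0 * L ^+ k) < d i.
Proof.
move=> t00 L1.
pose gap k := [forall i, (d i <= t0 * L ^+ k) || (L * (t0 * L ^+ k) < d i)].
case: (pickP (fun k : 'I_#|I|.+1 => gap k)) => [k /forallP gk|nogap].
  by exists k => [|i]; [rewrite -ltnS | apply/orP].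
have bad (k : 'I_#|I|.+1) :
    exists i, (t0 * L ^+ k < d i) && (d i <= L * (t0 * L ^+ k)).
  have /forallPn[j] := negbT (nogap k).
  by rewrite negb_or -ltNge -leNgt => h; exists j.
pose f k := xchoose (bad k).
have f_inj : injective f.
  suff H (k l : 'I_#|I|.+1) : f k = f l -> (k < l)%N -> False.
    move=> k l fkl; apply: ord_inj; apply/eqP.
    rewrite eqn_leq leqNgt [X in _ && X]leqNgt.
    by apply/andP; split; apply/negP; [exact: H (esym fkl) | exact: H fkl].
  move=> fkl kl; have /andP[_ h1] := xchooseP (bad k).
  have /andP[h2 _] := xchooseP (bad l).
  rewrite -/(f k) fkl in h1; have := lt_le_trans h2 h1.
  rewrite ltNge => /negP; apply.
  by rewrite mulrCA -exprS ler_wpM2l ?(ltW t00) // ler_weXn2l.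
by have := leq_card f f_inj; rewrite card_ord ltnn.
Qed.

Lemma equal_fibers_perm (T : eqType) n (f g : 'I_n -> T) :
    (forall a, a \in codom f ++ codom g ->
       #|[set i | f i == a]| = #|[set i | g i == a]|) ->
  exists s : 'S_n, forall i, f i = g (s i).
Proof.
move=> fib.
have cnt (h : 'I_n -> T) a : count_mem a (codom h) = #|[set i | h i == a]|.
  by rewrite codomE count_map enumT cardsE cardE /enum_mem size_filter.
have : perm_eq (codom f) [tuple g i | i < n].
  have -> : [tuple g i | i < n] = codom g :> seq T by rewrite codomE.
  by apply/allP => a /fib /=; rewrite !cnt => ->.
case/tuple_permP => s fs; exists s => i.
have := congr1 (fun u => nth (f i) u i) fs.
rewrite (nth_map i) ?size_enum_ord // nth_ord_enum (nth_map i) ?size_enum_ord //.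
by rewrite nth_ord_enum tnth_mktuple.
Qed.

Definition joint (T : Type) n (x y : 'I_n -> T) (u : 'I_n + 'I_n) : T :=
  match u with inl i => x i | inr i => y i end.

(** The gap in the distances makes being within t transitive, so two points have
    the same set of neighbours exactly when they are within t of each other:
    the set of neighbours serves as a name for the cluster. *)
Lemma cluster_matching (R : rcfType) n (x y : 'I_n -> R[i]) (K t : R) :
    4 ^+ n.+1 < K -> 0 < t ->
    (forall u v, modulus (joint x y u - joint x y v) <= t \/
       (8 * K + 8) * t < modulus (joint x y u - joint x y v)) ->
    (forall u s, 0 <= s <= 4 * K * t ->
       modulus (\prod_(i < n) (joint x y u + s%:C%C - x i) -
                \prod_(i < n) (joint x y u + s%:C%C - y i)) <= t ^+ n / 2) ->
  exists s : 'S_n, forall j, modulus (x j - y (s j)) <= t.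
Proof.
move=> K4 t0 gap close; set pt := joint x y in gap close.
have K1 : 1 <= K by rewrite (le_trans _ (ltW K4)) // exprn_ege1 // ler1n.
have trans u v w : modulus (pt u - pt v) <= t -> modulus (pt v - pt w) <= t ->
    modulus (pt u - pt w) <= t.
  move=> uv vw; have := modulus_triangle (pt u) (pt v) (pt w).
  have Lt : 2 * t <= (8 * K + 8) * t by rewrite ler_wpM2r ?(ltW t0) //; lra.
  case: (gap u w) => // h; lra.
pose cls u := [set v | modulus (pt v - pt u) <= t].
have clsE u v : (cls u == cls v) = (modulus (pt u - pt v) <= t).
  apply/eqP/idP => [uv|uv].
    have : u \in cls u by rewrite inE subrr Normc.normc0 ltW.
    by rewrite uv inE.
  by apply/setP => w; rewrite !inE; apply/idP/idP => h; apply: trans h _;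
    rewrite // modulusB.
have fib u : #|[set i | cls (inl i) == cls u]| = #|[set i | cls (inr i) == cls u]|.
  have card_xy : #|cluster x (pt u) t| = #|cluster y (pt u) t|.
    apply: (cluster_card_eq K4 t0) => [i|i|s]; last exact: close.
      exact: (gap (inl i) u).
    exact: (gap (inr i) u).
  transitivity #|cluster x (pt u) t|.
    by apply: eq_card => i; rewrite !inE clsE.
  by rewrite card_xy; apply: eq_card => i; rewrite !inE clsE.
have [|s sE] := @equal_fibers_perm _ n (fun i => cls (inl i)) (fun i => cls (inr i)).
  by move=> a; rewrite mem_cat => /orP[] /codomP[j ->].
by exists s => j; rewrite -(clsE (inl j) (inr (s j))) sE.
Qed.

(** Scales reach from c / N, where t^n dominates |p - q|, up to c L^m / N with m
    the number of pairs of points.  If the last one is at least 2, the diameter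
    of the unit disc, any permutation will do; otherwise all evaluation points
    stay in the disc of radius 1 + 8K, where |p - q| <= A N^-n. *)
Lemma close_power_sums_matching (R : realType) (n : nat) :
  exists2 C : R, 1 <= C &
    forall (N : R) (x y : 'I_n -> R[i]), 1 <= N ->
      (forall i, modulus (x i) <= 1) -> (forall i, modulus (y i) <= 1) ->
      (forall j : nat, (1 <= j <= n)%N ->
         modulus (\sum_(i < n) x i ^+ j - \sum_(i < n) y i ^+ j) <= N ^- n) ->
      exists s : 'S_n, forall j, modulus (x j - y (s j)) <= C * N^-1.
Proof.
case: (posnP n) => [->|n0].
  by exists 1 => // N x y *; exists 1%g => -[].
(* Naming the constants through existentials keeps towers of powers in unary
   numerals from being evaluated. *)
have [k0 k0E] : exists k0 : nat, k0 = (4 ^ n.+1).+1 by exists (4 ^ n.+1).+1.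
have [K KE] : exists K : R, K = k0%:R by exists k0%:R.
have K4 : 4 ^+ n.+1 < K by rewrite KE k0E -natrX ltr_nat.
have K1 : 1 <= K by rewrite KE k0E ler1n.
have [A AE] : exists A, A = (n.+1 * ((n * (n + 2 ^ n)) ^ n * (8 * k0).+1 ^ n))%N.
  by eexists.
have [m mE] : exists m, m = #|{: ('I_n + 'I_n) * ('I_n + 'I_n)}| by eexists.
pose L : R := 8 * K + 8.
pose c : R := (2 * A).+1%:R.
have L1 : 1 <= L by rewrite /L; lra.
have c1 : 1 <= c by rewrite ler1n.
have C1 : 1 <= c * L ^+ m by rewrite mulr_ege1 // exprn_ege1.
exists (c * L ^+ m) => // N x y N1 x1 y1 close.
have N0 : 0 < N by lra.
have [big|small] := lerP 2 (c * L ^+ m * N^-1).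
  exists 1%g => j; rewrite perm1; apply: le_trans big.
  have := modulus_triangle (x j) 0 (y j).
  by rewrite subr0 (modulusB 0) subr0; have := x1 j; have := y1 j; lra.
have t00 : 0 < c * N^-1 by rewrite mulr_gt0 ?invr_gt0 // (lt_le_trans ltr01).
have [k km gap] := scale_gap
  (fun u : ('I_n + 'I_n) * ('I_n + 'I_n) =>
     modulus (joint x y u.1 - joint x y u.2)) t00 L1.
set t := c * N^-1 * L ^+ k in gap.
have t0t : c * N^-1 <= t by rewrite ler_peMr ?(ltW t00) // exprn_ege1.
have t0 : 0 < t by exact: lt_le_trans t0t.
have tC : t <= c * L ^+ m * N^-1.
  by rewrite /t [leRHS]mulrAC ler_wpM2l ?(ltW t00) // ler_weXn2l // mE.
have t2 : t <= 2 by exact: le_trans tC (ltW small).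
have [|s sE] := @cluster_matching _ n x y K t K4 t0 (fun u v => gap (u, v)); last first.
  by exists s => j; exact: le_trans (sE j) tC.
move=> u s /andP[s0 sK]; set z := joint x y u + _.
have zb : modulus z <= (8 * k0).+1%:R.
  have := le_normcD (joint x y u) s%:C%C; rewrite -/z modulus_real ger0_norm //.
  have u1 : modulus (joint x y u) <= 1 by case: u {z}.
  have Kt : K * t <= K * 2 by rewrite ler_wpM2l // (le_trans ler01).
  rewrite -natr1 natrM -KE; rewrite -mulrA in sK; lra.
have toC (v : R[i]) (a : R) : modulus v <= a -> `|v| <= a%:C%C.
  by rewrite normCE lecR.
have natC (l : nat) : l%:R = (l%:R : R)%:C%C by rewrite rmorph_nat.
have := @horner_prod_XsubC_dist R[i] n x y (N ^- n)%:C%C z (8 * k0).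
rewrite -AE !natC -rmorphM => bound.
apply: (@le_trans _ _ (A%:R * N ^- n)).
  rewrite -lecR -normCE; apply: bound => [|i|i|l ln|].
  - by rewrite (lecR 0) invr_ge0 exprn_ge0 // ltW.
  - exact: (toC _ 1).
  - exact: (toC _ 1).
  - exact/toC/close.
  - exact: toC.
have h1 : c * N ^- n <= t ^+ n.
  apply: (@le_trans _ _ ((c * N^-1) ^+ n)).
    rewrite exprMn exprVn ler_wpM2r ?invr_ge0 ?exprn_ge0 ?(ltW N0) //.
    by rewrite ler_eXnr.
  by rewrite lerXn2r // nnegrE ltW.
have h2 : 0 < N ^- n by rewrite invr_gt0 exprn_gt0.
have h3 : c * N ^- n = 2 * (A%:R * N ^- n) + N ^- n.
  by rewrite /c -natr1 natrM; ring.
lra.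
Qed.

Theorem propositionA1 (R : realType) (n : nat) :
  exists C : R, 1 <= C /\
    forall (K : arch_local_field R) (N : R) (x y : 'I_n -> K),
      1 <= N ->
      (forall i, x i \in unit_ball K) ->
      (forall i, y i \in unit_ball K) ->
      (forall j : nat, (1 <= j <= n)%N ->
         absK K (\sum_(i < n) x i ^+ j - \sum_(i < n) y i ^+ j) <= N ^- n) ->
      exists s : 'S_n, forall j : 'I_n, absK K (x j - y (s j)) <= C * N^-1.
Proof.
have [C C1 H] := close_power_sums_matching R n.
exists C; split=> // -[] N x y N1 x1 y1 close; last exact: H close.
have [||j jn|s sE] := H N (fun i => (x i)%:C%C) (fun i => (y i)%:C%C) N1.
- by move=> i; rewrite modulus_real; exact: x1.
- by move=> i; rewrite modulus_real; exact: y1.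
- under eq_bigr => i _ do rewrite -rmorphXn.
  under [X in _ - X]eq_bigr => i _ do rewrite -rmorphXn.
  by rewrite -!rmorph_sum -rmorphB modulus_real; exact: close.
by exists s => j; have := sE j; rewrite -rmorphB modulus_real.
Qed.
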